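(* Let $T\in\mathcal{L}(\mathcal{H})$ have closed range and let $p$ be a complex polynomial in one variable such that $p(0)=0$. Suppose that $T$ is $p$-hypo-EP. If $T$ satisfies one of the following conditions: (1) $[T,\,p(T)T^\dagger]=0$; (2) $[TT^\dagger,\,p(T)+T^\dagger]=0$; (3) $[TT^\dagger,\,p(T)+T^*]=0$; then $T$ is $p$-EP.
   Context: $\mathcal{H}$ is a complex Hilbert space, $\mathcal{L}(\mathcal{H})$ is the algebra of bounded linear operators on $\mathcal{H}$, and $[A,B]=AB-BA$. For $T\in\mathcal{L}(\mathcal{H})$ with closed range, the Moore-Penrose inverse $T^\dagger$ is the unique operator with $TT^\dagger T=T$, $T^\dagger TT^\dagger=T^\dagger$, $(T^\dagger T)^*=T^\dagger T$, $(TT^\dagger)^*=TT^\dagger$. For a complex polynomial $p$ (the notions are introduced for nontrivial $p$), a closed range operator $T$ is $p$-hypo-EP ($p$-HEP) if $T^\dagger T\,p(T)=p(T)\,T^\dagger T$, and $p$-EP if $p(T)T^\dagger=T^\dagger p(T)$. *)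

(* Defs.v *)
From HB Require Import structures.
From mathcomp Require Import all_boot all_order all_algebra.
From mathcomp Require Export complex.
From mathcomp Require Import all_classical all_reals all_analysis.

Set Implicit Arguments.
Unset Strict Implicit.
Unset Printing Implicit Defensive.

Import Order.TTheory GRing.Theory Num.Theory.
Import numFieldNormedType.Exports.

Local Open Scope classical_set_scope.
Local Open Scope ring_scope.
Local Open Scope complex_scope.

(* The complex field is R[i] for an arbitrary R : realType; norms take values in
   R[i], and 0 <= z in R[i] means that z is a nonnegative real. The inner
   product is linear in its first argument. *)
HB.mixin Record CompleteNormedModule_isHilbert (R : realType) H
    of CompleteNormedModule R[i] H := {
  inner : {dot H for (@Num.conj R[i])} ;
  inner_norm : forall x : H, inner x x = `|x| ^+ 2
}.

#[short(type="hilbertType")]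
HB.structure Definition Hilbert (R : realType) :=
  { H of CompleteNormedModule R[i] H & CompleteNormedModule_isHilbert R H }.

Section bounded_operators.
Context {R : realType} {H : hilbertType R}.
Implicit Types (f g : H -> H).

Definition is_bounded_op f : Prop :=
  (forall (a : R[i]) x y, f (a *: x + y) = a *: f x + f y) /\
  (exists2 M : R[i], 0 <= M & forall x, `|f x| <= M * `|x|).

Definition bounded_op_pred : {pred H -> H} := mem [set f | is_bounded_op f].

Lemma is_bounded_op_submod_closed : submod_closed bounded_op_pred.
Proof.
split.
  rewrite inE /=; split=> [a x y|]; first by rewrite scaler0 addr0.
  by exists 0 => // x; rewrite normr0 mul0r.
move=> c f g; rewrite !inE /= => -[lf [M M0 fM]] [lg [N N0 gN]].
have E x : (c *: f + g) x = c *: f x + g x by [].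
split=> [a x y|].
  rewrite !E lf lg !scalerDr !scalerA [c * a]mulrC.
  by rewrite -!addrA; congr (_ + _); rewrite addrCA.
exists (`|c| * M + N); first by rewrite addr_ge0 // mulr_ge0.
move=> x; rewrite E mulrDl (le_trans (ler_normD _ _)) // lerD //.
by rewrite normrZ -mulrA ler_wpM2l.
Qed.

HB.instance Definition _ :=
  GRing.isSubmodClosed.Build R[i] (H -> H) bounded_op_pred
    is_bounded_op_submod_closed.

Record bounded_op_type := BoundedOp {
  bounded_op_fun :> H -> H ;
  bounded_op_subproof : bounded_op_fun \in bounded_op_pred
}.

HB.instance Definition _ := [isSub for bounded_op_fun].
HB.instance Definition _ := [Choice of bounded_op_type by <:].
HB.instance Definition _ := [SubChoice_isSubLmodule of bounded_op_type by <:].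

Implicit Types A B C : bounded_op_type.

Lemma bounded_opP A : is_bounded_op A.
Proof. by have := bounded_op_subproof A; rewrite inE. Qed.

Lemma bounded_op_eqP A B : A =1 B <-> A = B.
Proof. by split=> [AB|->//]; apply/val_inj/funext. Qed.

Lemma bounded_op_id_subproof : (@idfun H) \in bounded_op_pred.
Proof.
by rewrite inE; split=> //; exists 1 => // x; rewrite mul1r.
Qed.

Lemma bounded_op_comp_subproof A B : (A \o B) \in bounded_op_pred.
Proof.
have [lA [M M0 AM]] := bounded_opP A; have [lB [N N0 BN]] := bounded_opP B.
rewrite inE; split=> [a x y|]; first by rewrite /= lB lA.
exists (M * N) => [|x /=]; first exact: mulr_ge0.
by rewrite (le_trans (AM _)) // -mulrA ler_wpM2l.
Qed.

Definition bounded_op_id := BoundedOp bounded_op_id_subproof.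
Definition bounded_op_comp A B := BoundedOp (bounded_op_comp_subproof A B).

Lemma bounded_op_compA : associative bounded_op_comp.
Proof. by move=> A B C; apply/bounded_op_eqP. Qed.

Lemma bounded_op_comp1o : left_id bounded_op_id bounded_op_comp.
Proof. by move=> A; apply/bounded_op_eqP. Qed.

Lemma bounded_op_compo1 : right_id bounded_op_id bounded_op_comp.
Proof. by move=> A; apply/bounded_op_eqP. Qed.

Lemma bounded_op_compDl : left_distributive bounded_op_comp +%R.
Proof. by move=> A B C; apply/bounded_op_eqP. Qed.

Lemma bounded_op_compDr : right_distributive bounded_op_comp +%R.
Proof.
move=> A B C; apply/bounded_op_eqP => x /=.
by have [lA _] := bounded_opP A; have := lA 1 (B x) (C x); rewrite !scale1r.
Qed.

(* Only a pzRingType: the zero space is allowed, and then 1 = 0. *)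
HB.instance Definition _ := GRing.Zmodule_isPzRing.Build bounded_op_type
  bounded_op_compA bounded_op_comp1o bounded_op_compo1
  bounded_op_compDl bounded_op_compDr.

End bounded_operators.

Arguments bounded_op_type {R} H.
Notation "''L' ( H )" := (bounded_op_type H)
  (at level 8, format "''L' ( H )") : type_scope.

Section moore_penrose.
Context {R : realType} {H : hilbertType R}.
Implicit Types (A B T S : 'L(H)) (p : {poly R[i]}).

Definition commutator A B : 'L(H) := A * B - B * A.

Definition is_adjoint A B : Prop := forall x y, inner (A x) y = inner x (B y).

(* The adjoint exists by the Riesz representation theorem and is unique, so
   that the default value 0 is never used. *)
Definition adjoint A : 'L(H) := xget 0 [set B | is_adjoint A B].

Definition is_mp_inverse T S : Prop :=
  [/\ T * S * T = T, S * T * S = S,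
      adjoint (S * T) = S * T & adjoint (T * S) = T * S].

Definition closed_range T : Prop := closed (range T).

(* Meaningful when T has closed range, which is equivalent to the existence of
   a (necessarily unique) Moore-Penrose inverse. *)
Definition mp_inverse T : 'L(H) := xget 0 [set S | is_mp_inverse T S].

(* horner_alg is unavailable here, since it requires a nontrivial algebra. *)
Definition op_poly p T : 'L(H) := \sum_(i < size p) p`_i *: T ^+ i.

Definition p_hypo_EP p T : Prop :=
  closed_range T /\
  mp_inverse T * T * op_poly p T = op_poly p T * (mp_inverse T * T).

Definition p_EP p T : Prop :=
  closed_range T /\ op_poly p T * mp_inverse T = mp_inverse T * op_poly p T.

End moore_penrose.

(* Main.v *)
Require Import Defs.
From mathcomp Require Import all_boot all_order all_algebra.
From mathcomp Require Import all_classical all_reals all_analysis.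

(** Write [S] for the Moore-Penrose inverse of [T] and [a] for [p(T)].  Since
    [p] has no constant term, [a] is a multiple of [T] on both sides, hence
    [T S a = a] and [a S T = a]; being [p]-hypo-EP then means [S T a = a].
    The one missing absorption law is [a T S = a].  Once it holds, sliding [T]
    across [a] gives [a S = (S T a) S = S (a T) S = S a]
    ([commute_of_absorb]).

    Each of the three conditions yields that law.  Under (1) it is immediate:
    [a T S = T a S = a S T = a].  Under (2) and (3) the condition reads
    [a + T S b = a T S + b], with [b = S] or [b = T^*], because [b T S = b] in
    both cases.  Multiplying by [T] on the right removes [a], since [T S T = T],
    and leaves [T S (b T) = b T]; multiplying by [S] on the right turns this into
    [T S b = b], so that [a = a T S] ([absorb_of_commute_add]). *)

Import GRing.Theory Num.Theory.
Local Open Scope ring_scope.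
Local Open Scope complex_scope.

Lemma commute_of_absorb {A : pzRingType} {T S a : A} :
  GRing.comm T a -> S * T * a = a -> a * (T * S) = a -> a * S = S * a.
Proof.
by move=> Ta PA aQ; rewrite -[in LHS]PA -(mulrA S) Ta -!mulrA aQ.
Qed.

(** Condition (2) is the case [b = S], condition (3) the case [b = T^*]. *)
Lemma absorb_of_commute_add {A : pzRingType} {T S a b : A} :
  T * S * T = T -> T * S * a = a -> b * (T * S) = b ->
  GRing.comm (T * S) (a + b) -> a * (T * S) = a.
Proof.
move=> TST Qa bQ; rewrite /GRing.comm mulrDr mulrDl Qa bQ => E.
have Qb : T * S * b = b.
  have : (a + T * S * b) * T = (a * (T * S) + b) * T by rewrite E.
  rewrite !mulrDl -(mulrA a) TST => /addrI /(congr1 ( *%R^~ S)).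
  by rewrite -!(mulrA _ T S) -(mulrA _ b) bQ.
by move: E; rewrite Qb => /addIr.
Qed.

Section operators.
Context {R : realType} {H : hilbertType R}.
Implicit Types (A B T S : 'L(H)) (p : {poly R[i]}).

Lemma op_scalerAl (c : R[i]) A B : c *: (A * B) = (c *: A) * B.
Proof. exact/bounded_op_eqP. Qed.

Lemma op_scalerAr (c : R[i]) A B : c *: (A * B) = A * (c *: B).
Proof.
apply/bounded_op_eqP => x.
have [lA _] := bounded_opP A.
have A0 : A 0 = 0 by have := lA (-1) 0 0; rewrite !scaleN1r !addNr.
by have := lA c (B x) 0; rewrite A0 !addr0 => /esym.
Qed.

Lemma op_poly_factor p T : p.[0] = 0 ->
  exists q : 'L(H), op_poly p T = T * q /\ op_poly p T = q * T.
Proof.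
rewrite horner_coef0 => p0.
exists (\sum_(i < (size p).-1) p`_i.+1 *: T ^+ i); rewrite /op_poly.
case: (size p) => [|n]; first by rewrite !big_ord0 mulr0 mul0r.
rewrite big_ord_recl p0 scale0r add0r mulr_sumr mulr_suml.
split; apply: eq_bigr => i _.
  by rewrite -op_scalerAr -exprS.
by rewrite -op_scalerAl -exprSr.
Qed.

Lemma inner_injr (y z : H) : (forall x, inner x y = inner x z) -> y = z.
Proof.
move=> yz; apply/eqP; rewrite -subr_eq0 -normr_eq0 -sqrf_eq0.
by rewrite -inner_norm linearBr /= yz subrr.
Qed.

Lemma adjointP A : is_adjoint A (adjoint A) \/ adjoint A = 0.
Proof.
by rewrite /adjoint; case: xgetP => [B _ AB|]; [left|right].
Qed.

(** The default value [0] of [adjoint] does no harm here: it satisfies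
    [adjoint A = A] only for [A = 0], which is self-adjoint. *)
Lemma selfadjointP A : adjoint A = A -> is_adjoint A A.
Proof.
move=> AA; case: (adjointP A); first by rewrite AA.
by rewrite AA => -> x y; rewrite linear0l linear0r.
Qed.

(** Taking adjoints in [Q T = T], with [Q] self-adjoint. *)
Lemma adjoint_absorb {Q T} : adjoint Q = Q -> Q * T = T ->
  adjoint T * Q = adjoint T.
Proof.
move=> /selfadjointP Qa QT; case: (adjointP T) => [Ta|->]; last by rewrite mul0r.
apply/bounded_op_eqP => y; apply: inner_injr => x.
rewrite -[LHS]/(inner x (adjoint T (Q y))) -Ta -Qa -Ta.
by rewrite -[Q (T x)]/((Q * T) x) QT.
Qed.

Lemma mp_inverseP T : is_mp_inverse T (mp_inverse T) \/ mp_inverse T = 0.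
Proof.
by rewrite /mp_inverse; case: xgetP => [S _ TS|]; [left|right].
Qed.

End operators.

Theorem proposition7 (R : realType) (H : hilbertType R) (T : 'L(H))
    (p : {poly R[i]}) :
  closed_range T ->
  p.[0] = 0 ->
  p_hypo_EP p T ->
  [\/ commutator T (op_poly p T * mp_inverse T) = 0,
      commutator (T * mp_inverse T) (op_poly p T + mp_inverse T) = 0
    | commutator (T * mp_inverse T) (op_poly p T + adjoint T) = 0] ->
  p_EP p T.
Proof.
move=> clT p0 [_ hypo] conds; split=> //.
(* The default value [0] of [mp_inverse] commutes with every operator. *)
case: (mp_inverseP T) => [|->]; last by rewrite mulr0 mul0r.
move: hypo conds; set S := mp_inverse T; set a := op_poly p T.
move=> hypo conds [TST STS _ Qadj].
have [q [aTq aqT]] := op_poly_factor p T p0; rewrite -/a in aTq aqT.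
have Ta : GRing.comm T a by rewrite /GRing.comm {1}aqT aTq mulrA.
have Qa : T * S * a = a by rewrite aTq mulrA TST.
have aP : a * (S * T) = a by rewrite aqT -mulrA [T * _]mulrA TST.
have Pa : S * T * a = a by rewrite hypo.
apply: (commute_of_absorb Ta Pa).
case: conds => /subr0_eq E.
- by rewrite mulrA -Ta -mulrA E -mulrA.
- by apply: (absorb_of_commute_add TST Qa _ E); rewrite mulrA.
- exact: (absorb_of_commute_add TST Qa (adjoint_absorb Qadj TST) E).
Qed.
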